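(* Let $\kappa>\omega$ be a regular cardinal. There are models $\mathcal M_1\subseteq\mathcal M_2$ (a model and a submodel, in a common vocabulary) with $\mathcal M_1\neq\mathcal M_2$ and $|\mathcal M_1|=|\mathcal M_2|=\kappa$ such that (i) for every subset $A$ of the universe of $\mathcal M_1$ with $|A|<\kappa$, there is an isomorphism from $\mathcal M_2$ onto $\mathcal M_1$ which is the identity on $A$; (ii) $\sigma(\mathcal M_1)\le\kappa$.
   Context: $|\mathcal M|$ denotes the cardinality of the universe of $\mathcal M$, and $\sigma(\mathcal M)$ denotes the number of automorphisms of $\mathcal M$. In this statement no restriction is placed on the vocabulary; it may contain relation symbols of infinite arity less than $\kappa$. *)

(* Defs.v *)
From HB Require Import structures.
From mathcomp Require Import all_boot all_order.
From mathcomp Require Import boolp wochoice classical_sets functions cardinality.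

Set Implicit Arguments.
Unset Strict Implicit.
Unset Printing Implicit Defensive.

Local Open Scope classical_set_scope.
Local Open Scope card_scope.
Local Open Scope order_scope.

Definition card_lt T U (A : set T) (B : set U) : Prop :=
  A #<= B /\ A #!= B.

Section Cardinals.
Variables (d : Order.disp_t) (K : orderType d).

Definition below (a : K) : set K := [set b | b < a].

(* K is order isomorphic to a von Neumann cardinal; the ordinals smaller than
   that cardinal are represented by the elements a of K, a standing for the
   order type of below a. *)
Definition initial_ordinal : Prop :=
  well_order (<=%O : rel K) /\ forall a : K, card_lt (below a) [set: K].

Definition cofinal (C : set K) : Prop :=
  forall a : K, exists2 c, C c & a <= c.

(* An infinite cardinal equal to its own cofinality. *)
Definition regular_cardinal : Prop :=
  [/\ initial_ordinal, infinite_set [set: K]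
    & forall C : set K, cofinal C -> C #= [set: K]].

(* Function symbols (constants being those of arity 0) are finitary, while the
   arity of a relation symbol is an arbitrary ordinal smaller than K. *)
Record vocabulary := Vocabulary {
  rel_symbol : Type;
  rel_arity : rel_symbol -> K;
  fun_symbol : Type;
  fun_arity : fun_symbol -> nat }.

Record model (L : vocabulary) := Model {
  universe :> Type;
  rel_interp (r : rel_symbol L) : set (below (rel_arity r) -> universe);
  fun_interp (f : fun_symbol L) : ('I_(fun_arity f) -> universe) -> universe }.

End Cardinals.

Section Models.
Variables (d : Order.disp_t) (K : orderType d) (L : vocabulary K).

Definition fun_closed (M : model L) (U : set M) : Prop :=
  forall (f : fun_symbol L) (t : 'I_(fun_arity f) -> M),
    (forall i, U (t i)) -> U (fun_interp t).

Definition submodel (M : model L) (U : set M) (hU : fun_closed U) : model L :=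
  @Model d K L U
    (fun r => [set t | rel_interp (\val \o t : below (rel_arity r) -> M)])
    (fun f t => exist (fun x => x \in U) (fun_interp (\val \o t))
       (mem_set (hU f (\val \o t) (fun i => set_valP (t i))))).

Definition isomorphism (M N : model L) (h : M -> N) : Prop :=
  [/\ bijective h,
      forall (r : rel_symbol L) (t : below (rel_arity r) -> M),
        rel_interp t <-> rel_interp (h \o t)
    & forall (f : fun_symbol L) (t : 'I_(fun_arity f) -> M),
        h (fun_interp t) = fun_interp (h \o t)].

Definition automorphisms (M : model L) : set (M -> M) :=
  [set h | isomorphism h].

End Models.

Arguments automorphisms {d K L} M.

(* Main.v *)
(* The universe of M2 is K * nat, a family of K chains i -> (i,0), (i,1), ...,
   and M1 omits one point (o,0). Call a map f tame if, up to finitely many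
   exceptional points, it fixes the bottoms (i,0) and commutes with
   (i,n) -> (i,n+1), and if it has finite fibres. Fix an infinite arity c < K;
   for each c-sequence s of points there is a relation holding of all f o s with
   f tame. For i <> o, pushing (o,0) into the bottom of the i-th chain and moving
   that chain up by one step is an isomorphism of M2 onto M1, because it is
   tame with a tame left inverse; fewer than K points miss some chain i, and
   are then fixed by it. An automorphism agrees with a tame map on every countable
   set. Since an infinite set of exceptional points contains a countable one,
   the automorphism itself has only finitely many exceptional points, and is
   determined by its values there. So there are at most as many automorphisms as
   finite sequences of elements of K, that is K many since K * K has cardinality
   K. *)
Require Import Defs.
From HB Require Import structures.
From mathcomp Require Import all_boot all_order.
From mathcomp Require Import boolp wochoice classical_sets functions cardinality.
Import Order.TTheory.

Set Implicit Arguments.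
Unset Strict Implicit.
Unset Printing Implicit Defensive.

Local Open Scope classical_set_scope.
Local Open Scope card_scope.

(** * Comparing cardinalities by injections *)

Lemma card_le_inj X Y (A : set X) (D : set Y) (f : X -> Y) :
  (forall x, A x -> D (f x)) -> {in A &, injective f} -> A #<= D.
Proof.
move=> fD finj; rewrite -(card_le_eql (inj_card_eq finj)).
by apply: subset_card_le => _ [x Ax <-]; exact: fD.
Qed.

(** The point [y] makes [X] inhabited, so that the injection can be a total function. *)
Lemma card_le_ex_inj X (y : X) Y (A : set X) (D : set Y) :
  D #<= A -> exists2 f : Y -> X,
    (forall x, D x -> A (f x)) & {in D &, injective f}.
Proof.
elim/Ppointed: X => X in y A *; first by have := no y.
by move=> /pcard_leP[f]; exists f; [move=> x; exact: funS|exact: inj].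
Qed.

Lemma card_setM X X' Y Y' (A : set X) (B : set X') (C : set Y) (D : set Y') :
  A #<= C -> B #<= D -> A `*` B #<= C `*` D.
Proof.
move=> AC BD; have [->|/set0P[[a b] [/= Aa Bb]]] := eqVneq (A `*` B) set0.
  exact: card_ge0.
have /set0P[c Cc] : C != set0.
  by apply: contraPneq Aa => C0; move: AC; rewrite C0 card_le0 => /eqP ->.
have /set0P[d Dd] : D != set0.
  by apply: contraPneq Bb => D0; move: BD; rewrite D0 card_le0 => /eqP ->.
have [f fC finj] := card_le_ex_inj c AC.
have [g gD ginj] := card_le_ex_inj d BD.
apply: (@card_le_inj _ _ _ _ (fun u => (f u.1, g u.2))).
  by move=> u [Au Bu]; split; [exact: fC|exact: gD].
move=> [x y] [x' y'] /set_mem[/= Ax By] /set_mem[/= Ax' By'] [fxx' gyy'].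
by congr pair; [apply: finj|apply: ginj]; rewrite ?inE.
Qed.

(* Hilbert's hotel. *)
Lemma card_le_setU1 X (x : X) (D : set X) :
  infinite_set D -> x |` D #<= D.
Proof.
move=> Dinf; have [Dx|nDx] := pselect (D x).
  by apply: subset_card_le => y [->|].
have /infiniteP/(card_le_ex_inj x)[e eD einj] := Dinf.
have {}einj : injective e by move=> m n; apply: einj; rewrite inE.
pose r y := if pselect (exists n, e n = y) is left en then e (sval (cid en)).+1
            else y.
have rE n : r (e n) = e n.+1.
  rewrite /r; case: pselect => [en|[]]; last by exists n.
  by case: cid => m /= /einj ->.
have rN y : ~ (exists n, e n = y) -> r y = y.
  by rewrite /r; case: pselect.
apply: (@card_le_inj _ _ _ _ (fun y => if `[< y = x >] then e 0%N else r y)).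
  move=> y; case: asboolP => [_ _|yx [//|Dy]]; first exact: eD.
  by have [[n <-]|/rN ->//] := pselect (exists n, e n = y); rewrite rE; exact: eD.
move=> y z _ _; case: asboolP => [->|yx]; case: asboolP => [->//|zx].
- have [[n <-]|zN] := pselect (exists n, e n = z).
    by rewrite rE => /einj.
  by rewrite rN // => ez; case: zN; exists 0%N.
- have [[n <-]|yN] := pselect (exists n, e n = y).
    by rewrite rE => /einj.
  by rewrite rN // => ez; case: yN; exists 0%N.
- have [[n <-]|yN] := pselect (exists n, e n = y);
    have [[m <-]|zN] := pselect (exists n, e n = z).
  + by rewrite !rE => /einj[->].
  + by rewrite rE (rN z) // => ez; case: zN; exists n.+1.
  + by rewrite rE (rN y) // => ez; case: yN; exists m.+1.
  + by rewrite !rN.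
Qed.

(* Greedily map each x to an element of D not yet used by its predecessors. *)
Lemma card_le_well_founded X Y (A : set X) (D : set Y) (lt : X -> X -> Prop) :
    well_founded lt -> (forall x y, lt x y \/ x = y \/ lt y x) ->
    (forall x, A x -> ~ (D #<= A `&` lt^~ x)) ->
  A #<= D.
Proof.
elim/Pchoice: Y => Y in D * => wf tri AD.
have [->|/set0P[x0 Ax0]] := eqVneq A set0.
  exact: card_ge0.
have /set0P[y0 Dy0] : D != set0.
  by apply/eqP => D0; apply: (AD _ Ax0); rewrite D0; exact: card_ge0.
(* For [x] in [A] the default [y0] is never reached: if no element of [D] were free, [D] would
   inject into the predecessors of [x]. *)
pose step x (rec : forall x', lt x' x -> Y) :=
  xget y0 (D `\` [set y | exists x' (l : lt x' x), A x' /\ rec x' l = y]).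
pose F := Fix wf (fun=> Y) step.
have FE x : F x = xget y0 (D `\` (F @` (A `&` lt^~ x))).
  rewrite /F Fix_eq; last first.
    move=> {}x f g fg; congr (xget _ (_ `\` _)); apply/seteqP.
    by split=> y [x' [l [Ax' <-]]]; exists x', l; rewrite fg.
  congr (xget _ (_ `\` _)); apply/seteqP; split=> y.
    by move=> [x' [l [Ax' <-]]]; exists x'.
  by move=> [x' [Ax' l] <-]; exists x', l.
have FD x : A x -> (D `\` (F @` (A `&` lt^~ x))) (F x).
  move=> Ax; rewrite [F x]FE; apply: (@xgetPex _ y0).
  apply: contrapT => none; apply: (AD _ Ax).
  apply: card_le_trans (card_image_le F _); apply: subset_card_le => y Dy.
  by apply: contrapT => nFy; apply: none; exists y.
have Flt x x' : A x -> A x' -> lt x' x -> F x' <> F x.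
  by move=> Ax Ax' l FF; have [_] := FD x Ax; apply; exists x'.
apply: (@card_le_inj _ _ _ _ F) => [x /FD[]//|x x' /set_mem Ax /set_mem Ax' FF].
by have [l|[//|l]] := tri x x'; [case: (Flt x' x)|case: (Flt x x')].
Qed.

(** * Squares of infinite well-ordered cardinals *)

Section Hessenberg.
Variables (d : Order.disp_t) (K : orderType d).
Hypothesis K_wo : well_order (<=%O : rel K).
Local Open Scope order_scope.

Definition atmost (m : K) : set K := [set x | x <= m].

Lemma lt_wf : well_founded (fun x y : K => x < y).
Proof.
move=> x; apply: contrapT => nAx.
pose S := [pred y | `[< ~ Acc (fun x y : K => x < y) y >]].
have [|z [[/asboolP nAz zmin] _]] := @K_wo S.
  by exists x; apply/asboolP.
apply: nAz; constructor => y yz; apply: contrapT => /asboolP /zmin.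
by rewrite leNgt yz.
Qed.

(** Gödel's canonical well-order: the predecessors of a pair lie in the square of the initial
    segment closed at its maximum. *)
Definition goedel_lt (u v : K * K) :=
  Order.max u.1 u.2 < Order.max v.1 v.2 \/
  Order.max u.1 u.2 = Order.max v.1 v.2 /\
    (u.1 < v.1 \/ u.1 = v.1 /\ u.2 < v.2).

Lemma goedel_lt_wf : well_founded goedel_lt.
Proof.
suff acc m x y : Order.max x y = m -> Acc goedel_lt (x, y).
  by move=> [x y]; exact: acc.
elim/(well_founded_ind lt_wf): m x y => m IHm x.
elim/(well_founded_ind lt_wf): x => x IHx y.
elim/(well_founded_ind lt_wf): y => y IHy mE.
constructor => -[x' y'] [/=|/= [mE' [|[xx ]]]].
- by rewrite mE => /IHm; apply.
- by move=> /IHx; apply; rewrite mE'.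
- by rewrite xx in mE' * => /IHy; apply; rewrite mE'.
Qed.

Lemma goedel_lt_total u v : goedel_lt u v \/ u = v \/ goedel_lt v u.
Proof.
case: u v => [x y] [x' y']; rewrite /goedel_lt /=.
have [?|?|->] := ltgtP (Order.max x y) (Order.max x' y').
- by left; left.
- by right; right; left.
have [?|?|->] := ltgtP x x'.
- by left; right; split; [|left].
- by right; right; right; split; [|left].
have [?|?|->] := ltgtP y y'.
- by left; right; split; [|right].
- by right; right; right; split; [|right].
- by right; left.
Qed.

(** Otherwise [D] injects into the predecessors of some pair, hence into the square of [atmost m]
    for its maximum [m]. That square is finite or no larger than [atmost m], and both are
    excluded. *)
Lemma card_square_step (D : set K) : infinite_set D ->
    (forall k, D k -> infinite_set (atmost k) ->
      atmost k `*` atmost k #<= atmost k) ->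
    (forall k, D k -> ~ (D #<= atmost k)) ->
  D `*` D #<= D.
Proof.
move=> Dinf IH Dk; apply: (card_le_well_founded goedel_lt_wf goedel_lt_total).
move=> [x y] [/= Dx Dy] Dle.
have Dm : D (Order.max x y) by case: (leP x y).
have {}Dle : D #<= atmost (Order.max x y) `*` atmost (Order.max x y).
  apply: card_le_trans Dle _; apply: subset_card_le => -[x' y'] [_ lt] /=.
  suff : Order.max x' y' <= Order.max x y by rewrite ge_max => /andP[].
  by case: lt => [/ltW|[-> _]].
have [fin|inf] := pselect (finite_set (atmost (Order.max x y))).
  apply: Dinf; apply: card_le_finite Dle _; exact: finite_setX.
by apply: (Dk _ Dm); apply: card_le_trans Dle (IH _ Dm inf).
Qed.

Lemma atmostE m : atmost m = m |` below m.
Proof.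
by apply/seteqP; split=> x; rewrite /atmost /below /= le_eqVlt => /predU1P.
Qed.

Lemma card_atmost m : infinite_set (atmost m) -> atmost m #<= below m.
Proof.
move=> inf; rewrite atmostE; apply: card_le_setU1; apply: contra_not inf => fin.
by rewrite atmostE finite_setU; split.
Qed.

Lemma card_square_atmost m : infinite_set (atmost m) ->
  atmost m `*` atmost m #<= atmost m.
Proof.
elim/(well_founded_ind lt_wf): m => m IH inf.
(* Either a smaller segment is already as large, and its square bound is inherited, or [below m]
   exceeds every [atmost k] with [k < m], as the step lemma requires. *)
have [[k km mk]|nk] := pselect (exists2 k, k < m & atmost m #<= atmost k).
  have kinf : infinite_set (atmost k).
    by apply: contra_not inf; exact: card_le_finite.
  apply: card_le_trans (card_setM mk mk) _.
  apply: card_le_trans (IH _ km kinf) _; apply: subset_card_le => x /= xk.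
  exact: le_trans xk (ltW km).
have mb := card_atmost inf.
apply: card_le_trans (card_setM mb mb) _.
apply: (@card_le_trans _ _ _ (below m)); last first.
  by apply: subset_card_le => x /ltW.
apply: card_square_step => [|k /= km|k /= km le].
- by apply: contra_not inf; exact: card_le_finite.
- exact: IH.
- by apply: nk; exists k => //; exact: card_le_trans mb le.
Qed.

Lemma card_square : (forall a : K, card_lt (below a) [set: K]) ->
  infinite_set [set: K] ->
  [set: K] `*` [set: K] #<= [set: K].
Proof.
move=> Kini inf; apply: card_square_step => // k _ => [|le].
  exact: card_square_atmost.
have kinf : infinite_set (atmost k) by apply: contra_not inf; exact: card_le_finite.
have [bk /negP] := Kini k; apply; rewrite card_eq_le bk /=.
exact: card_le_trans le (card_atmost kinf).
Qed.

End Hessenberg.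

(** Provides the infinite arity. If all proper initial segments were finite, the greedy embedding
    would put [K] inside [nat]. *)
Lemma exists_infinite_below d (K : orderType d) :
    well_order (<=%O : rel K) -> card_lt [set: nat] [set: K] ->
  exists a : K, infinite_set (below a).
Proof.
move=> K_wo [natK /negP natNK]; apply: contrapT => nex.
apply: natNK; rewrite card_eq_le natK /=.
apply: card_le_well_founded (lt_wf K_wo) _ _ => [x y|a _ nata].
  by have [||->] := ltgtP x y; [left|right; right|right; left].
apply: nex; exists a; apply/infiniteP; apply: card_le_trans nata _.
by apply: subset_card_le => y [].
Qed.

Lemma card_seq X : infinite_set [set: X] ->
  [set: X] `*` [set: X] #<= [set: X] -> [set: seq X] #<= [set: X].
Proof.
move=> Xinf XX; have [x0 _] := infinite_setN0 Xinf.
have /infiniteP/(card_le_ex_inj x0)[e _ einj] := Xinf.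
have [p _ pinj] := card_le_ex_inj x0 XX.
have {}pinj (u v x y : X) : p (u, x) = p (v, y) -> u = v /\ x = y.
  by move=> puv; have [] : (u, x) = (v, y) by apply: pinj; rewrite ?inE.
(* The distinct tags [e 0] and [e 1] separate the empty sequence from the others; the second [e 0]
   is filler. *)
pose fix code (s : seq X) : X :=
  if s is x :: s' then p (e 1%N, p (x, code s')) else p (e 0%N, e 0%N).
apply: (@card_le_inj _ _ _ _ code) => // s t _ _.
elim: s t => [|x s IHs] [|y t] //= /pinj[].
- by move=> e01; have := einj _ _ _ _ e01; rewrite !inE => /(_ I I).
- by move=> e01; have := einj _ _ _ _ e01; rewrite !inE => /(_ I I).
- by move=> _ /pinj[-> /IHs ->].
Qed.

(** * Tame maps on a family of chains *)

Section Chains.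
Variables (I : Type).
Implicit Types (f g : I * nat -> I * nat) (x : I * nat).

Definition shift x := (x.1, x.2.+1).

(** At a regular point the value is forced by the value one step lower, so a map is determined by
    its values at its defects. *)
Definition regular_at f x :=
  match x.2 with
  | 0 => f x = x
  | n.+1 => f x = shift (f (x.1, n))
  end.

Definition defects f : set (I * nat) := [set x | ~ regular_at f x].

(* The second condition makes tame maps closed under composition. *)
Definition tame f := finite_set (defects f) /\
  forall B, finite_set B -> finite_set (f @^-1` B).

Lemma regular_at_comp f g x : regular_at f x -> regular_at g x ->
  regular_at g (f x) -> regular_at (g \o f) x.
Proof.
by case: x => i [|n]; rewrite /regular_at /= => -> //; case: (f (i, n)).
Qed.

(** A defect of the composite is a defect of [f], a defect of [g], or a point sent by [f] to a
    defect of [g]; finite fibres of [f] bound the last kind. *)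
Lemma tame_comp f g : tame f -> tame g -> tame (g \o f).
Proof.
move=> [Df ff] [Dg fg]; split=> [|B /fg/ff //].
apply: (@sub_finite_set _ _ (defects f `|` defects g `|` f @^-1` defects g)).
  move=> x gfx; have [fx|] := pselect (regular_at f x); last by left; left.
  have [gx|] := pselect (regular_at g x); last by left; right.
  by right=> gfx'; apply: gfx; exact: regular_at_comp.
by rewrite !finite_setU; split; [split|exact: ff].
Qed.

Lemma tame_id : tame id.
Proof. by split=> //; apply: (@sub_finite_set _ _ set0) => // -[i [|n]] []. Qed.

(** Truncated predecessor: bottoms stay put, so regularity at [x] only involves the values at [x]
    and [pred_row x]. *)
Definition pred_row x := (x.1, x.2.-1).

Lemma eq_regular_at f g x : f x = g x -> f (pred_row x) = g (pred_row x) ->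
  regular_at f x -> regular_at g x.
Proof. by case: x => i [|n]; rewrite /regular_at /pred_row /= => -> // ->. Qed.

(* An infinite set of defects would already show up on a countable set. *)
Lemma finite_defects (S : Type) (A : set S) k :
    infinite_set A ->
    (forall s : A -> I * nat, exists2 f, tame f & k \o s = f \o s) ->
  finite_set (defects k).
Proof.
move=> /infiniteP; rewrite -(card_le_eqr (card_setT A)) => /pcard_surjP[q qsurj].
move=> ks; apply: contrapT => /[dup]/infinite_setN0[x0 _] /infiniteP/(card_le_ex_inj x0).
move=> [e ek einj].
(* Interleaves the defects [e n] of [k] with their predecessors, so that a tame [f] agreeing with
   [k] along [u] inherits all these defects. *)
pose u n := if odd n then pred_row (e n./2) else e n./2.
have [f [Df _] kf] := ks (u \o q).
have {}kf n : k (u n) = f (u n).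
  by have [//|a _ <-] := qsurj n; have := congr1 (fun h => h a) kf.
apply/infiniteP: Df; apply: (@card_le_inj _ _ _ _ e) => // n _ fe.
apply: ek => //; apply: eq_regular_at fe.
  by have := kf n.*2; rewrite /u odd_double doubleK.
by have := kf n.*2.+1; rewrite /u /= odd_double /= uphalf_double.
Qed.

End Chains.

Lemma card_finite_defects I : infinite_set [set: I] ->
    [set: I] `*` [set: I] #<= [set: I] ->
  [set f : I * nat -> I * nat | finite_set (defects f)] #<= [set: I].
Proof.
elim/Pchoice: I => I Iinf II; have [i0 _] := infinite_setN0 Iinf.
have /infiniteP natI := Iinf.
have InatI : [set: I] `*` [set: nat] #<= [set: I].
  exact: card_le_trans (card_setM (card_lexx _) natI) II.
have [r _ rinj] := card_le_ex_inj i0 (card_le_trans (card_setM InatI InatI) II).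
have {}rinj x y x' y' : r (x, y) = r (x', y') -> x = x' /\ y = y'.
  by move=> rxy; have [] : (x, y) = (x', y') by apply: rinj; rewrite ?inE.
have /choice[l lP] (f : I * nat -> I * nat) : exists l : seq (I * nat),
    finite_set (defects f) -> defects f = [set` l].
  have [/finite_seqP[l lE]|nfin] := pselect (finite_set (defects f)); first by exists l.
  by exists [::].
apply: card_le_trans (card_seq Iinf II).
apply: (@card_le_inj _ _ _ _ (fun f => [seq r (x, f x) | x <- l f])) => // f g.
move=> /set_mem /lP Df /set_mem /lP Dg rfg.
have sub (f1 g1 : I * nat -> I * nat) x : defects f1 = [set` l f1] ->
    [seq r (x, f1 x) | x <- l f1] = [seq r (x, g1 x) | x <- l g1] ->
    ~ regular_at f1 x -> f1 x = g1 x.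
  move=> D1 fg1 nreg; have : defects f1 x by [].
  rewrite D1 /= => /(map_f (fun x => r (x, f1 x))); rewrite fg1.
  by move=> /mapP[y yl /rinj[-> ->]].
(* A defect of either map occurs, with its value, in the common list; the remaining points are
   regular for both, and induction up the chain settles them. *)
have fgP x : f x = g x \/ (regular_at f x /\ regular_at g x).
  have [fx|/(sub _ _ _ Df rfg)->] := pselect (regular_at f x); last by left.
  have [gx|/(sub _ _ _ Dg (esym rfg))->] := pselect (regular_at g x); last by left.
  by right.
apply/funext => -[i n]; elim: n => [|n IHn].
  by have [//|[-> ->]] := fgP (i, 0%N).
by have [//|[-> ->]] := fgP (i, n.+1); rewrite /= IHn.
Qed.

(** * Pushing one point into the bottom of a chain *)

Section Push.
Variables (I : eqType) (o a : I).
Hypothesis oa : o != a.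
Implicit Types x : I * nat.

Definition push x :=
  if x.1 == a then shift x else if x == (o, 0%N) then (a, 0%N) else x.

(** Total left inverse of [push]. It sends both [(a, 0)] and [(o, 0)] to [(o, 0)], so it is not
    injective. *)
Definition pull x :=
  if x.1 == a then (if x.2 is n.+1 then (a, n) else (o, 0%N)) else x.

Lemma pushK : cancel push pull.
Proof.
case=> i n; rewrite /push /=; have [->|ia] := eqVneq i a.
  by rewrite /pull /= eqxx.
have [[-> ->]|_] := eqVneq (i, n) (o, 0%N); rewrite /pull /= ?eqxx //.
by rewrite (negbTE ia).
Qed.

Lemma pullK x : x != (o, 0%N) -> push (pull x) = x.
Proof.
case: x => i n xo; rewrite /pull /=; have [->|ia] := eqVneq i a.
  by case: n {xo} => [|n]; rewrite /push /= ?(negbTE oa) eqxx.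
by rewrite /push /= (negbTE ia) (negbTE xo).
Qed.

Lemma push_neq x : push x != (o, 0%N).
Proof.
case: x => i n; rewrite /push /=; case: ifP => [_|ia].
  by rewrite xpair_eqE andbF.
by case: ifP => [_|-> //]; rewrite xpair_eqE eq_sym (negbTE oa).
Qed.

Lemma push_id x : x != (o, 0%N) -> x.1 != a -> push x = x.
Proof. by rewrite /push => /negbTE -> /negbTE ->. Qed.

Lemma tame_push : tame push.
Proof.
split=> [|B Bfin]; last first.
  by apply: finite_preimage Bfin => x y _ _; exact: (can_inj pushK).
(* Both [(o, 0)] and [(a, 0)] are moved bottoms; [(o, 1)] is fixed while the point under it has left
   the chain. *)
apply: (@sub_finite_set _ _ [set (o, 0%N); (o, 1%N); (a, 0%N)]) => //.
move=> [i n]; apply: contra_notP => /not_orP[/not_orP[]].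
rewrite /regular_at /push /=; case: n => [|n] /eqP no0 /eqP no1 /eqP na0.
  by rewrite (negbTE no0) ifN //; apply: contraNneq na0 => ->.
have [->//|ia] := eqVneq i a; rewrite xpair_eqE andbF.
by rewrite ifN //; apply: contraNneq no1 => -[-> ->].
Qed.

Lemma tame_pull : tame pull.
Proof.
split=> [|B Bfin]; last first.
  apply: (@sub_finite_set _ _ ([set (o, 0%N)] `|` push @` B)).
    move=> x /= Bx; have [->|xo] := eqVneq x (o, 0%N); first by left.
    by right; exists (pull x); rewrite ?pullK.
  by rewrite finite_setU; split=> //; exact: finite_image.
(* The bottom [(a, 0)] leaves its chain, and [(a, 1)] takes its place instead of following it. *)
apply: (@sub_finite_set _ _ [set (a, 0%N); (a, 1%N)]) => //.
move=> [i n]; apply: contra_notP => /not_orP[].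
rewrite /regular_at /pull /=; case: n => [|n] /eqP na0 /eqP na1.
  by rewrite ifN //; apply: contraNneq na0 => ->.
have [ia|//] := eqVneq i a; case: n na0 na1 => [|n] _ //.
by rewrite ia eqxx.
Qed.

End Push.

(** * The model, its punctured submodel and the automorphisms *)

Section Model.
Variables (d : Order.disp_t) (K : orderType d).

(* The relation symbols are the tuples of the model itself: [s] names the set
   of the images of [s] under tame maps. *)
Definition chain_vocabulary (c : K) : vocabulary K :=
  @Vocabulary _ K (below c -> K * nat) (fun=> c) void (fun=> 0%N).

Definition chain_model (c : K) : model (chain_vocabulary c) :=
  @Model _ K (chain_vocabulary c) (K * nat)%type
    (fun s => [set t | exists2 f, tame f & t = f \o s])
    (fun f => match f with end).

Lemma fun_closed_chain_model c (U : set (chain_model c)) : fun_closed U.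
Proof. by case. Qed.

Variables (o c : K).

Definition punctured : set (chain_model c) := [set~ (o, 0%N)].

Let M1 := submodel (@fun_closed_chain_model c punctured).

Lemma mem_push a (oa : o != a) (x : chain_model c) : push o a x \in punctured.
Proof. by apply/mem_set/eqP; exact: push_neq. Qed.

Definition push_iso a (oa : o != a) : chain_model c -> M1 :=
  fun x => exist _ (push o a x) (mem_push oa x).

(** A tame witness is carried forward by composing with [push] and back by composing with [pull]. *)
Lemma isomorphism_push a (oa : o != a) : isomorphism (push_iso oa).
Proof.
split=> [|s t|[]].
- exists (fun y : M1 => pull o a (val y)) => [x|y]; first exact: pushK.
  by apply: val_inj; apply: pullK => //; apply/eqP; exact: (set_valP y).
- split=> [[f ftame ->]|[f ftame tE]].
    by exists (push o a \o f) => //; apply: tame_comp => //; exact: tame_push.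
  exists (pull o a \o f); first by apply: tame_comp => //; exact: tame_pull.
  apply/funext => i; have := congr1 (fun h => h i) tE.
  by move=> /= /(congr1 (pull o a)); rewrite pushK.
Qed.

Lemma card_automorphisms_punctured (a : K) : o != a ->
    infinite_set (below c) -> infinite_set [set: K] ->
    [set: K] `*` [set: K] #<= [set: K] ->
  automorphisms M1 #<= [set: K].
Proof.
move=> oa cinf Kinf KK; apply: card_le_trans (card_finite_defects Kinf KK).
(* Transporting [sigma] along [push_iso] gives a self-map of the full set of chains, where defects
   can be counted. *)
apply: (@card_le_inj _ _ _ _
    (fun sigma : M1 -> M1 => pull o a \o val \o sigma \o push_iso oa)).
  move=> sigma [_ sigmaR _] /=; apply: (finite_defects cinf) => s.
  (* The relation named by [s] holds at [s] itself; its preservation yields a tame map agreeing with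
     the transported automorphism on [s]. *)
  have Rs : @rel_interp _ _ _ (chain_model c) s s.
    by exists id => //; exact: tame_id.
  have [_ isoR _] := isomorphism_push oa.
  have /isoR/sigmaR[f ftame fE] := Rs.
  exists (pull o a \o f); first by apply: tame_comp => //; exact: tame_pull.
  apply/funext => i /=; congr pull; exact: (congr1 (fun h => h i) fE).
move=> sigma tau _ _ st; apply/funext => y.
have valN (z : M1) : val z != (o, 0%N) by apply/eqP; exact: (set_valP z).
have yE : y = push_iso oa (pull o a (val y)).
  by apply: val_inj => /=; rewrite pullK //; exact: valN.
apply: val_inj; rewrite yE.
have := congr1 (fun h => h (pull o a (val y))) st.
by move=> /= /(congr1 (push o a)); rewrite !pullK //; exact: valN.
Qed.

End Model.

Arguments punctured {d K} o c.

Theorem theorem7 (d : Order.disp_t) (K : orderType d)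
    (K_regular : regular_cardinal K)
    (K_gt_omega : card_lt [set: nat] [set: K]) :
  exists (L : vocabulary K) (M2 : model L) (U : set M2) (hU : fun_closed U),
    let M1 := submodel hU in
    [/\ U <> [set: M2],
        [set: M1] #= [set: K] /\ [set: M2] #= [set: K],
        (forall A : set M1, card_lt A [set: K] ->
           exists h : M2 -> M1,
             isomorphism h /\ (forall a : M1, A a -> h (\val a) = a))
      & automorphisms M1 #<= [set: K]].
Proof.
have [[K_wo Kini] Kinf _] := K_regular.
have KK := card_square K_wo Kini Kinf.
have [c cinf] := exists_infinite_below K_wo K_gt_omega.
have [o _] := infinite_setN0 Kinf.
(* If only [o] could be missing from [A], then [A] would be infinite and would absorb [o], giving it
   the size of [K]. *)
have fresh (A : set K) : card_lt A [set: K] -> exists2 a, o != a & ~ A a.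
  move=> [AK /negP nAK]; apply: contrapT => none; apply: nAK.
  rewrite card_eq_le AK /=.
  have KoA : [set: K] `<=` o |` A.
    move=> a _; have [->|oa] := eqVneq a o; first by left.
    by right; apply: contrapT => nAa; apply: none; exists a; rewrite 1?eq_sym.
  have Ainf : infinite_set A.
    move=> Afin; apply: Kinf; apply: sub_finite_set KoA _.
    by rewrite finite_setU.
  exact: card_le_trans (subset_card_le KoA) (card_le_setU1 _ Ainf).
have [a0 oa0 _] : exists2 a, o != a & ~ set0 a.
  apply: fresh; split; first exact: card_ge0.
  rewrite card_eq_sym card_eq0; apply/eqP => K0.
  by apply: Kinf; rewrite K0; exact: finite_set0.
exists (chain_vocabulary c), (chain_model c), (punctured o c),
  (@fun_closed_chain_model _ _ c (punctured o c)) => M1.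
have M2K : [set: chain_model c] #<= [set: K].
  apply: (@card_le_trans _ _ _ ([set: K] `*` [set: nat])).
    by apply: subset_card_le.
  exact: card_le_trans (card_setM (card_lexx _) K_gt_omega.1) KK.
have KM1 : [set: K] #<= [set: M1].
  (* Level 1 avoids the removed point, which is a bottom. *)
  have mem_top (a : K) : ((a, 1%N) : chain_model c) \in punctured o c.
    by apply/mem_set => -[].
  apply: (@card_le_inj _ _ _ _ (fun a => exist _ (a, 1%N) (mem_top a))) => //.
  by move=> a b _ _ [].
have M1M2 : [set: M1] #<= [set: chain_model c].
  by apply: (@card_le_inj _ _ _ _ val) => // x y _ _; exact: val_inj.
split.
- by move=> UT; have /(_ erefl) : punctured o c (o, 0%N) by rewrite UT.
- split; rewrite card_eq_le; apply/andP; split => //.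
    exact: card_le_trans M1M2 M2K.
  exact: card_le_trans KM1 M1M2.
- move=> A [AK /negP nAK].
  (* The chains that meet [A]; pushing into any other chain fixes [A] pointwise. *)
  pose B := (fun x : M1 => (val x).1) @` A.
  have [a oa nBa] : exists2 a, o != a & ~ B a.
    apply: fresh; split; first exact: card_le_trans (card_image_le _ _) AK.
    apply/negP => /card_esym BK; apply: nAK; rewrite card_eq_le AK /=.
    by rewrite (card_le_eql BK) card_image_le.
  exists (@push_iso _ _ o c a oa); split; first exact: isomorphism_push.
  move=> x Ax; apply: val_inj; apply: push_id.
    by apply/eqP; exact: (set_valP x).
  by apply: contra_notN nBa => /eqP <-; exists x.
- exact: card_automorphisms_punctured oa0 cinf Kinf KK.
Qed.
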